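(* Any hermitian bilinear form $\lambda$ has a universal commutative quadratic refinement $\mu^c_\lambda$, i.e. $(\lambda,\mu^c_\lambda)$ is initial in the category of commutative quadratic refinements of $\lambda$. In fact, the forgetful functor $R(\lambda,\mu)=\lambda$ from the category $\mathsf{CQF}$ of commutative quadratic forms to the category $\mathsf{HF}$ of hermitian forms has a left adjoint $L:\mathsf{HF}\to\mathsf{CQF}$, $L(\lambda)=(\lambda,\mu^c_\lambda)$.
   Context: A commutative quadratic group $\mathfrak M=(M_e\xrightarrow{h}M_{ee}\xrightarrow{p}M_e)$ consists of two abelian groups $M_e,M_{ee}$ and homomorphisms $h,p$ with $ph=2\,\mathrm{id}$. Then $*:=hp-\mathrm{id}$ is an involution on $M_{ee}$. A morphism $\beta:\mathfrak M\to\mathfrak M'$ is a pair of homomorphisms $\beta_e:M_e\to M'_e$, $\beta_{ee}:M_{ee}\to M'_{ee}$ commuting with $h,h'$ and $p,p'$. A commutative quadratic form $(\lambda,\mu):A\to\mathfrak M$ on an abelian group $A$ consists of a commutative quadratic group $\mathfrak M$, a bilinear map $\lambda:A\times A\to M_{ee}$ and a map $\mu:A\to M_e$ with $\mu(a+a')=\mu(a)+\mu(a')+p(\lambda(a,a'))$ and $h(\mu(a))=\lambda(a,a)$ for all $a,a'\in A$. Then $\lambda$ is hermitian with respect to $*=hp-\mathrm{id}$. Morphisms in $\mathsf{CQF}$ are pairs $(\alpha:A\to A',\ \beta:\mathfrak M\to\mathfrak M')$ of morphisms with $\lambda'(\alpha a_1,\alpha a_2)=\beta_{ee}\lambda(a_1,a_2)$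 and $\mu'(\alpha a)=\beta_e\mu(a)$. A hermitian form $\lambda:A\times A\to(M,* )$ is a bilinear map from an abelian group $A$ to an abelian group $M$ with involution $*$ such that $\lambda(a',a)=\lambda(a,a')^*$. Morphisms in $\mathsf{HF}$ are pairs $(\alpha:A\to A',\ \beta_{ee}:(M,* )\to(M',*'))$ of homomorphisms, $\beta_{ee}$ compatible with involutions, with $\lambda'(\alpha a_1,\alpha a_2)=\beta_{ee}\lambda(a_1,a_2)$. The functor $R$ forgets $\mu$, $M_e$ and $\beta_e$, and equips $M_{ee}$ with $*=hp-\mathrm{id}$. A commutative quadratic refinement of $\lambda:A\times A\to(M,* )$ is a commutative quadratic form $(\lambda,\mu):A\to\mathfrak M$ with $M_{ee}=M$ and $hp-\mathrm{id}=*$; morphisms of such refinements are the morphisms in $\mathsf{CQF}$ lying over the identity of $\lambda$. *)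

(* Defs.v *)
From HB Require Import structures.
From mathcomp Require Import all_boot all_algebra.
From mathcomp Require Import boolp.

Set Implicit Arguments.
Unset Strict Implicit.
Unset Printing Implicit Defensive.

Import GRing.Theory.
Local Open Scope ring_scope.

Record category := Category {
  obj :> Type;
  hom : obj -> obj -> Type;
  idm : forall x, hom x x;
  comp : forall x y z, hom y z -> hom x y -> hom x z;
  comp_idl : forall x y (f : hom x y), comp (idm y) f = f;
  comp_idr : forall x y (f : hom x y), comp f (idm x) = f;
  comp_assoc : forall w x y z (f : hom y z) (g : hom x y) (k : hom w x),
    comp f (comp g k) = comp (comp f g) k
}.
Arguments hom {c} x y : rename.
Arguments idm {c} x.
Arguments comp {c x y z} f g.

Record functor (C D : category) := Functor {
  fobj :> C -> D;
  fmap : forall x y : C, hom x y -> hom (fobj x) (fobj y);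
  fmap_id : forall x : C, fmap (idm x) = idm (fobj x);
  fmap_comp : forall (x y z : C) (f : hom y z) (g : hom x y),
    fmap (comp f g) = comp (fmap f) (fmap g)
}.
Arguments fmap {C D} F {x y} _ : rename.

Definition initial (C : category) (x : C) : Prop :=
  forall y : C, exists! f : hom x y, True.

Record adjunction (C D : category) (L : functor C D) (R : functor D C) :=
  Adjunction {
  transpose : forall (x : C) (y : D), hom (L x) y -> hom x (R y);
  transpose_bij : forall (x : C) (y : D), bijective (@transpose x y);
  transpose_natl : forall (x' x : C) (y : D) (f : hom x' x) (g : hom (L x) y),
    transpose (comp g (fmap L f)) = comp (transpose g) f;
  transpose_natr : forall (x : C) (y y' : D) (f : hom y y') (g : hom (L x) y),
    transpose (comp f g) = comp (fmap R f) (transpose g)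
}.

Definition left_adjoint (C D : category) (L : functor C D) (R : functor D C)
  : Prop := inhabited (adjunction L R).

(* Abelian groups are zmodTypes: under the classical axioms of boolp, any type
   with an abelian group law can be given this structure. *)

Lemma additive_eq (U V : zmodType) (f g : {additive U -> V}) :
  f =1 g -> f = g.
Proof.
case: f g => [f [[fD]]] [g [[gD]]] fg.
have {}fg : f = g by apply/funext.
by subst g; rewrite (Prop_irrelevance fD gD).
Qed.

Definition add_id (U : zmodType) : {additive U -> U} := idfun.

Definition add_comp (U V W : zmodType) (f : {additive V -> W})
  (g : {additive U -> V}) : {additive U -> W} := f \o g.

Definition biadditive (A B M : zmodType) (lam : A -> B -> M) : Prop :=
  (forall b, {morph lam^~ b : a a' / a + a'}) /\
  (forall a, {morph lam a : b b' / b + b'}).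

Record hform := HForm {
  hf_A : zmodType;
  hf_M : zmodType;
  hf_star : {additive hf_M -> hf_M};
  hf_lam : hf_A -> hf_A -> hf_M;
  hf_starK : involutive hf_star;
  hf_biadd : biadditive hf_lam;
  hf_herm : forall a a', hf_lam a' a = hf_star (hf_lam a a')
}.

Record hform_hom (X Y : hform) := HFormHom {
  hfh_A : {additive hf_A X -> hf_A Y};
  hfh_M : {additive hf_M X -> hf_M Y};
  hfh_star : forall x, hfh_M (hf_star X x) = hf_star Y (hfh_M x);
  hfh_lam : forall a1 a2,
    hf_lam (hfh_A a1) (hfh_A a2) = hfh_M (hf_lam a1 a2)
}.

Lemma hform_hom_eq (X Y : hform) (f g : hform_hom X Y) :
  hfh_A f =1 hfh_A g -> hfh_M f =1 hfh_M g -> f = g.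
Proof.
case: f g => [fA fM f1 f2] [gA gM g1 g2] /= /additive_eq eA /additive_eq eM.
subst gA gM.
by rewrite (Prop_irrelevance f1 g1) (Prop_irrelevance f2 g2).
Qed.

Definition hform_id (X : hform) : hform_hom X X :=
  @HFormHom X X (add_id _) (add_id _) (fun=> erefl) (fun _ _ => erefl).

Section HFormComp.
Variables (X Y Z : hform) (f : hform_hom Y Z) (g : hform_hom X Y).

Fact hform_comp_star x :
  add_comp (hfh_M f) (hfh_M g) (hf_star X x) =
  hf_star Z (add_comp (hfh_M f) (hfh_M g) x).
Proof. by rewrite /= !hfh_star. Qed.

Fact hform_comp_lam a1 a2 :
  hf_lam (add_comp (hfh_A f) (hfh_A g) a1) (add_comp (hfh_A f) (hfh_A g) a2) =
  add_comp (hfh_M f) (hfh_M g) (hf_lam a1 a2).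
Proof. by rewrite /= !hfh_lam. Qed.

Definition hform_comp : hform_hom X Z :=
  HFormHom hform_comp_star hform_comp_lam.

End HFormComp.

Definition HF : category.
Proof.
by refine (@Category hform hform_hom hform_id hform_comp _ _ _) => *;
  apply: hform_hom_eq.
Defined.

Record cqgroup := CQGroup {
  cq_e : zmodType;
  cq_ee : zmodType;
  cq_h : {additive cq_e -> cq_ee};
  cq_p : {additive cq_ee -> cq_e};
  cq_ph : forall x, cq_p (cq_h x) = x *+ 2
}.

Definition cq_star (M : cqgroup) : {additive cq_ee M -> cq_ee M} :=
  (cq_h M \o cq_p M) \- idfun.

Fact cq_starK (M : cqgroup) : involutive (cq_star M).
Proof.
move=> x; rewrite /cq_star /= [cq_p M (_ - _)]raddfB cq_ph mulr2n addrK.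
by rewrite subKr.
Qed.

Record cqgroup_hom (M N : cqgroup) := CQGroupHom {
  cqh_e : {additive cq_e M -> cq_e N};
  cqh_ee : {additive cq_ee M -> cq_ee N};
  cqh_h : forall x, cqh_ee (cq_h M x) = cq_h N (cqh_e x);
  cqh_p : forall y, cqh_e (cq_p M y) = cq_p N (cqh_ee y)
}.

Definition is_cqform (A : zmodType) (M : cqgroup) (lam : A -> A -> cq_ee M)
    (mu : A -> cq_e M) : Prop :=
  [/\ biadditive lam,
      forall a a', mu (a + a') = mu a + mu a' + cq_p M (lam a a')
    & forall a, cq_h M (mu a) = lam a a].

Record cqform := CQForm {
  cqf_A : zmodType;
  cqf_M : cqgroup;
  cqf_lam : cqf_A -> cqf_A -> cq_ee cqf_M;
  cqf_mu : cqf_A -> cq_e cqf_M;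
  cqf_ax : is_cqform cqf_lam cqf_mu
}.

Record cqform_hom (X Y : cqform) := CQFormHom {
  cqfh_A : {additive cqf_A X -> cqf_A Y};
  cqfh_M : cqgroup_hom (cqf_M X) (cqf_M Y);
  cqfh_lam : forall a1 a2,
    cqf_lam (cqfh_A a1) (cqfh_A a2) = cqh_ee cqfh_M (cqf_lam a1 a2);
  cqfh_mu : forall a, cqf_mu (cqfh_A a) = cqh_e cqfh_M (cqf_mu a)
}.

Lemma cqgroup_hom_eq (M N : cqgroup) (f g : cqgroup_hom M N) :
  cqh_e f =1 cqh_e g -> cqh_ee f =1 cqh_ee g -> f = g.
Proof.
case: f g => [fe fee f1 f2] [ge gee g1 g2] /= /additive_eq ee /additive_eq eee.
subst ge gee.
by rewrite (Prop_irrelevance f1 g1) (Prop_irrelevance f2 g2).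
Qed.

Lemma cqform_hom_eq (X Y : cqform) (f g : cqform_hom X Y) :
  cqfh_A f =1 cqfh_A g ->
  cqh_e (cqfh_M f) =1 cqh_e (cqfh_M g) ->
  cqh_ee (cqfh_M f) =1 cqh_ee (cqfh_M g) -> f = g.
Proof.
case: f g => [fA fM f1 f2] [gA gM g1 g2] /= /additive_eq eA ee eee.
have eM := cqgroup_hom_eq ee eee; subst gA gM.
by rewrite (Prop_irrelevance f1 g1) (Prop_irrelevance f2 g2).
Qed.

Definition cqgroup_id (M : cqgroup) : cqgroup_hom M M :=
  @CQGroupHom M M (add_id _) (add_id _) (fun=> erefl) (fun=> erefl).

Definition cqform_id (X : cqform) : cqform_hom X X :=
  @CQFormHom X X (add_id _) (cqgroup_id _) (fun _ _ => erefl) (fun=> erefl).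

Section CQGroupComp.
Variables (M N P : cqgroup) (f : cqgroup_hom N P) (g : cqgroup_hom M N).

Fact cqgroup_comp_h x :
  add_comp (cqh_ee f) (cqh_ee g) (cq_h M x) =
  cq_h P (add_comp (cqh_e f) (cqh_e g) x).
Proof. by rewrite /= !cqh_h. Qed.

Fact cqgroup_comp_p y :
  add_comp (cqh_e f) (cqh_e g) (cq_p M y) =
  cq_p P (add_comp (cqh_ee f) (cqh_ee g) y).
Proof. by rewrite /= !cqh_p. Qed.

Definition cqgroup_comp : cqgroup_hom M P :=
  CQGroupHom cqgroup_comp_h cqgroup_comp_p.

End CQGroupComp.

Section CQFormComp.
Variables (X Y Z : cqform) (f : cqform_hom Y Z) (g : cqform_hom X Y).

Fact cqform_comp_lam a1 a2 :
  cqf_lam (add_comp (cqfh_A f) (cqfh_A g) a1)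
          (add_comp (cqfh_A f) (cqfh_A g) a2) =
  cqh_ee (cqgroup_comp (cqfh_M f) (cqfh_M g)) (cqf_lam a1 a2).
Proof. by rewrite /= !cqfh_lam. Qed.

Fact cqform_comp_mu a :
  cqf_mu (add_comp (cqfh_A f) (cqfh_A g) a) =
  cqh_e (cqgroup_comp (cqfh_M f) (cqfh_M g)) (cqf_mu a).
Proof. by rewrite /= !cqfh_mu. Qed.

Definition cqform_comp : cqform_hom X Z :=
  CQFormHom cqform_comp_lam cqform_comp_mu.

End CQFormComp.

Definition CQF : category.
Proof.
by refine (@Category cqform cqform_hom cqform_id cqform_comp _ _ _) => *;
  apply: cqform_hom_eq.
Defined.

Fact cqf_biadd (X : cqform) : biadditive (@cqf_lam X).
Proof. by case: (cqf_ax X). Qed.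

Fact cqf_herm (X : cqform) (a a' : cqf_A X) :
  cqf_lam a' a = cq_star (cqf_M X) (cqf_lam a a').
Proof.
case: (cqf_ax X) => [[lDl lDr] muD hmu].
set s := cq_h _ (cq_p _ (cqf_lam a a')).
have E : s = cqf_lam a' a + cqf_lam a a'.
  apply: (addrI (cqf_lam a a + cqf_lam a' a')).
  have := hmu (a + a'); rewrite muD !raddfD /= !hmu lDl !lDr /= => ->.
  by rewrite addrACA [RHS]addrACA [cqf_lam a a' + _]addrC.
by rewrite /cq_star /= -/s E addrK.
Qed.

Definition R_obj (X : cqform) : hform :=
  @HForm (cqf_A X) (cq_ee (cqf_M X)) (cq_star (cqf_M X)) (@cqf_lam X)
    (@cq_starK (cqf_M X)) (cqf_biadd X) (@cqf_herm X).

Fact R_hom_star (X Y : cqform) (f : cqform_hom X Y) x :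
  cqh_ee (cqfh_M f) (cq_star (cqf_M X) x) =
  cq_star (cqf_M Y) (cqh_ee (cqfh_M f) x).
Proof. by rewrite /cq_star /= raddfB cqh_h cqh_p. Qed.

Definition R_hom (X Y : cqform) (f : cqform_hom X Y) :
    hform_hom (R_obj X) (R_obj Y) :=
  @HFormHom (R_obj X) (R_obj Y) (cqfh_A f) (cqh_ee (cqfh_M f))
    (R_hom_star f) (@cqfh_lam X Y f).

Definition R : functor CQF HF.
Proof.
by refine (@Functor CQF HF R_obj R_hom _ _) => *; apply: hform_hom_eq.
Defined.

Record refinement (X : hform) := Refinement {
  ref_e : zmodType;
  ref_h : {additive ref_e -> hf_M X};
  ref_p : {additive hf_M X -> ref_e};
  ref_ph : forall x, ref_p (ref_h x) = x *+ 2;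
  ref_M := CQGroup ref_ph;
  ref_mu : hf_A X -> ref_e;
  ref_star : forall x, cq_star ref_M x = hf_star X x;
  ref_ax : @is_cqform (hf_A X) ref_M (@hf_lam X) ref_mu
}.

Definition ref_form (X : hform) (r : refinement X) : cqform :=
  CQForm (ref_ax r).

(* [R (ref_form r)] and [X] have the same groups and the same bilinear map, and
   their involutions agree pointwise; [ref_over r] is the resulting identity. *)
Definition ref_over (X : hform) (r : refinement X) :
    @hom HF (R (ref_form r)) X :=
  @HFormHom (R_obj (ref_form r)) X (add_id _) (add_id _) (@ref_star X r)
    (fun _ _ => erefl).

Definition over_id (X : hform) (r s : refinement X)
    (f : @hom CQF (ref_form r) (ref_form s)) : Prop :=
  comp (ref_over s) (fmap R f) = ref_over r.

Definition ref_hom (X : hform) (r s : refinement X) :=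
  {f : @hom CQF (ref_form r) (ref_form s) | over_id f}.

Lemma ref_hom_eq (X : hform) (r s : refinement X) (f g : ref_hom r s) :
  sval f = sval g -> f = g.
Proof. by case: f g => [f fP] [g gP] /=; apply: eq_exist. Qed.

Fact over_id_id (X : hform) (r : refinement X) :
  over_id (@idm CQF (ref_form r)).
Proof. by rewrite /over_id fmap_id comp_idr. Qed.

Fact over_id_comp (X : hform) (r s t : refinement X)
    (f : ref_hom s t) (g : ref_hom r s) :
  over_id (comp (sval f) (sval g)).
Proof.
by case: f g => [f fP] [g gP]; rewrite /over_id fmap_comp comp_assoc fP.
Qed.

Definition ref_comp (X : hform) (r s t : refinement X)
    (f : ref_hom s t) (g : ref_hom r s) : ref_hom r t :=
  exist _ (comp (sval f) (sval g)) (over_id_comp f g).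

Definition refinements (X : hform) : category.
Proof.
refine (@Category (refinement X) (@ref_hom X)
          (fun r => exist _ (idm _) (over_id_id r)) (@ref_comp X) _ _ _).
- by move=> r s f; apply: ref_hom_eq; exact: comp_idl.
- by move=> r s f; apply: ref_hom_eq; exact: comp_idr.
- by move=> r s t u f g k; apply: ref_hom_eq; exact: comp_assoc.
Defined.

(* Main.v *)
From HB Require Import structures.
From mathcomp Require Import all_boot all_algebra.
From mathcomp Require Import boolp.
Require Import Defs.

(** The data of a commutative quadratic refinement of [lam : A * A -> (M, star)]
    contain a homomorphism [p : M -> N] and a map [mu : A -> N] with
    [mu (a + a') = mu a + mu a' + p (lam a a')], [p (star m) = p m] and
    [p (lam a a) = 2 (mu a)]; call this a quadratic pair with values in [N].
    These conditions do not mention [h], and they only ask for equations in [N],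
    so there is a universal quadratic pair, with values in a group [pair_group].

    The first condition makes the elements [mu a + p m] closed under addition
    and opposite, so this group is a quotient of the set [A * M].
    Two words [(a, m)] are identified when they take the same value under every
    quadratic pair; the group laws then hold because they hold in each [N]
    ([pair_groupP]).

    The homomorphism [h] is itself given by universality: [m |-> m + star m] and
    [a |-> lam a a] form a quadratic pair with values in [M].  This yields a
    refinement [univ_ref] of [lam].  If [Y] is a commutative quadratic form, a
    morphism [lam -> R Y] pulls the pair [(p, mu)] of [Y] back to a quadratic
    pair on [lam], whence a unique map out of [pair_group]; so [lam -> R Y]
    factors uniquely through [univ_ref] ([univ_ref_universal]).  Applied to the
    refinements of [lam] this is initiality; applied to all [Y] it says that the
    canonical arrows [lam -> R (univ_ref lam)] are universal, which is the same
    as a left adjoint of [R] ([universal_left_adjoint]). *)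

Set Implicit Arguments.
Unset Strict Implicit.
Unset Printing Implicit Defensive.

Import GRing.Theory.
Local Open Scope ring_scope.
Local Open Scope quotient_scope.

(** * Adjoints from universal arrows *)

Definition universal_arrow (C D : category) (R : functor D C) (x : C) (d : D)
    (u : hom x (R d)) : Prop :=
  forall (y : D) (f : hom x (R y)),
    exists! g : hom d y, comp (fmap R g) u = f.

Section UniversalArrows.
Variables (C D : category) (R : functor D C) (Lo : C -> D).
Variable u : forall x, hom x (R (Lo x)).
Hypothesis uP : forall x, universal_arrow (u x).

Let fact x y (f : hom x (R y)) : hom (Lo x) y := sval (cid (uP f)).

Let factK x y (f : hom x (R y)) : comp (fmap R (fact f)) (u x) = f.
Proof. by rewrite /fact; case: cid => g []. Qed.

Let fact_uniq x y (g g' : hom (Lo x) y) :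
  comp (fmap R g) (u x) = comp (fmap R g') (u x) -> g = g'.
Proof.
move=> E; have [k [_ kP]] := uP (comp (fmap R g') (u x)).
by rewrite -(kP g E) -(kP g').
Qed.

Let Lmap x y (f : hom x y) := fact (comp (u y) f).

Let Lmap_id x : Lmap (idm x) = idm (Lo x).
Proof. by apply: fact_uniq; rewrite factK fmap_id comp_idl comp_idr. Qed.

Let Lmap_comp x y z (f : hom y z) (g : hom x y) :
  Lmap (comp f g) = comp (Lmap f) (Lmap g).
Proof.
by apply: fact_uniq; rewrite fmap_comp -comp_assoc !factK !comp_assoc factK.
Qed.

Lemma universal_left_adjoint :
  exists L : functor C D, (forall x, L x = Lo x) /\ left_adjoint L R.
Proof.
exists (Functor Lmap_id Lmap_comp); split=> //.
apply/inhabits.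
apply: (@Adjunction C D (Functor Lmap_id Lmap_comp) R
  (fun x y (g : hom (Lo x) y) => comp (fmap R g) (u x))) => /=.
- by move=> x y; exists (@fact x y) => g; [apply: fact_uniq|]; rewrite factK.
- by move=> x' x y f g; rewrite fmap_comp -comp_assoc factK comp_assoc.
- by move=> x y y' f g; rewrite fmap_comp comp_assoc.
Qed.

End UniversalArrows.

(** * The universal quadratic pair *)

Definition quadratic_pair (X : hform) (N : zmodType)
    (p : {additive hf_M X -> N}) (mu : hf_A X -> N) : Prop :=
  [/\ forall a a', mu (a + a') = mu a + mu a' + p (hf_lam a a'),
      forall m, p (hf_star X m) = p m
    & forall a, p (hf_lam a a) = mu a *+ 2].

Section Words.
Variable X : hform.
Implicit Types (w : hf_A X * hf_M X) (N : zmodType).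

Definition word_eval N (p : {additive hf_M X -> N}) (mu : hf_A X -> N) w :=
  mu w.1 + p w.2.

(** The correction cancels the term [p (lam a a')] of [mu (a + a')]. *)
Definition word_add w w' :=
  (w.1 + w'.1, w.2 + w'.2 - hf_lam w.1 w'.1).

(** The correction comes from [0 = mu (a - a) = mu a + mu (- a) - p (lam a a)]. *)
Definition word_opp w := (- w.1, - w.2 - hf_lam w.1 w.1).

Lemma word_evalD N p mu w w' : @quadratic_pair X N p mu ->
  word_eval p mu (word_add w w') = word_eval p mu w + word_eval p mu w'.
Proof.
case=> muD _ _; rewrite /word_eval /= muD raddfB raddfD /=.
by rewrite -addrA [p _ + (_ - _)]addrC subrK addrACA.
Qed.

Lemma hf_lam0l (a : hf_A X) : hf_lam 0 a = 0.
Proof.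
have [lDl _] := hf_biadd X.
by apply: (addIr (hf_lam 0 a)); rewrite -lDl !add0r.
Qed.

Lemma quadratic_pair0 N p mu : @quadratic_pair X N p mu -> mu 0 = 0.
Proof.
case=> muD _ _; have := muD 0 0; rewrite hf_lam0l raddf0 !addr0.
by rewrite -[LHS]add0r => /addIr.
Qed.

Lemma word_eval0 N p mu : @quadratic_pair X N p mu -> word_eval p mu 0 = 0.
Proof.
by move=> /quadratic_pair0 mu0; rewrite /word_eval mu0 raddf0 addr0.
Qed.

Lemma word_evalN N p mu w : @quadratic_pair X N p mu ->
  word_eval p mu (word_opp w) = - word_eval p mu w.
Proof.
move=> pmu; apply: (addIr (word_eval p mu w)).
rewrite addNr -word_evalD // -(word_eval0 pmu); congr word_eval.
have [lDl _] := hf_biadd X; case: w => a m; rewrite /word_add /word_opp /=.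
congr pair; first by rewrite addNr.
have -> : hf_lam (- a) a = - hf_lam a a.
  by apply: (addIr (hf_lam a a)); rewrite -lDl !addNr hf_lam0l.
by rewrite opprK addrAC subrK addNr.
Qed.

(** Quantifying over all [N] is harmless: the formula is a proposition, so the
    quotient lives in the same universe as [hf_A X] and [hf_M X] and is itself
    one of the groups [N]. *)
Definition word_equiv w w' : bool :=
  `[< forall N p mu, @quadratic_pair X N p mu ->
        word_eval p mu w = word_eval p mu w' >].

Lemma word_equiv_class : equiv_class_of word_equiv.
Proof.
split=> [w|w w'|w' w w''].
- exact/asboolP.
- by apply/asboolP/asboolP => E N p mu /E.
- move=> /asboolP E /asboolP E'; apply/asboolP => N p mu pmu.
  by rewrite (E N p mu) // (E' N p mu).
Qed.

Canonical word_equiv_rel := EquivRelPack word_equiv_class.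

Definition pair_group := {eq_quot word_equiv}.
HB.instance Definition _ := Choice.on pair_group.
HB.instance Definition _ := EqQuotient.on pair_group.

Definition pair_desc N p mu of @quadratic_pair X N p mu :=
  fun x : pair_group => word_eval p mu (repr x).
Arguments pair_desc : simpl never.

Lemma pair_desc_pi N p mu (pmu : @quadratic_pair X N p mu) w :
  pair_desc pmu (\pi_pair_group w) = word_eval p mu w.
Proof.
have /eqmodP/asboolP := reprK (\pi_pair_group w); exact.
Qed.

(** The maps to all the groups [N] are jointly injective: this reduces each law
    of [pair_group] to the same law in [N]. *)
Lemma pair_groupP (x y : pair_group) :
  (forall N p mu (pmu : @quadratic_pair X N p mu),
     pair_desc pmu x = pair_desc pmu y) -> x = y.
Proof.
move=> E; rewrite -[x]reprK -[y]reprK; apply/eqmodP/asboolP => N p mu pmu.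
exact: (E N p mu pmu).
Qed.

Definition pair_add (x y : pair_group) :=
  \pi_pair_group (word_add (repr x) (repr y)).
Definition pair_opp (x : pair_group) := \pi_pair_group (word_opp (repr x)).
Definition pair_zero := \pi_pair_group (0 : hf_A X * hf_M X).

Lemma pair_desc_add N p mu (pmu : @quadratic_pair X N p mu) :
  {morph pair_desc pmu : x y / pair_add x y >-> x + y}.
Proof. by move=> x y; rewrite pair_desc_pi word_evalD. Qed.

Lemma pair_desc_opp N p mu (pmu : @quadratic_pair X N p mu) :
  {morph pair_desc pmu : x / pair_opp x >-> - x}.
Proof. by move=> x; rewrite pair_desc_pi word_evalN. Qed.

Lemma pair_desc_zero N p mu (pmu : @quadratic_pair X N p mu) :
  pair_desc pmu pair_zero = 0.
Proof. by rewrite pair_desc_pi word_eval0. Qed.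

Lemma pair_addA : associative pair_add.
Proof.
by move=> x y z; apply: pair_groupP => N p mu e; rewrite !pair_desc_add addrA.
Qed.

Lemma pair_addC : commutative pair_add.
Proof.
by move=> x y; apply: pair_groupP => N p mu e; rewrite !pair_desc_add addrC.
Qed.

Lemma pair_add0 : left_id pair_zero pair_add.
Proof.
move=> x; apply: pair_groupP => N p mu e.
by rewrite pair_desc_add pair_desc_zero add0r.
Qed.

Lemma pair_addN : left_inverse pair_zero pair_opp pair_add.
Proof.
move=> x; apply: pair_groupP => N p mu e.
by rewrite pair_desc_add pair_desc_opp pair_desc_zero addNr.
Qed.

HB.instance Definition _ :=
  GRing.isZmodule.Build pair_group pair_addA pair_addC pair_add0 pair_addN.

Lemma pair_descB N p mu (pmu : @quadratic_pair X N p mu) :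
  zmod_morphism (pair_desc pmu).
Proof. by move=> x y; rewrite pair_desc_add pair_desc_opp. Qed.

HB.instance Definition _ N p mu (pmu : @quadratic_pair X N p mu) :=
  GRing.isZmodMorphism.Build pair_group N (pair_desc pmu) (pair_descB pmu).

Definition univ_p (m : hf_M X) : pair_group := \pi_pair_group (0, m).
Definition univ_mu (a : hf_A X) : pair_group := \pi_pair_group (a, 0).

Lemma pair_desc_p N p mu (pmu : @quadratic_pair X N p mu) m :
  pair_desc pmu (univ_p m) = p m.
Proof.
by rewrite pair_desc_pi /word_eval /= (quadratic_pair0 pmu) add0r.
Qed.

Lemma pair_desc_mu N p mu (pmu : @quadratic_pair X N p mu) a :
  pair_desc pmu (univ_mu a) = mu a.
Proof. by rewrite pair_desc_pi /word_eval /= raddf0 addr0. Qed.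

Lemma univ_pB : zmod_morphism univ_p.
Proof.
move=> m m'; apply: pair_groupP => N p mu e.
by rewrite raddfB /= !pair_desc_p raddfB.
Qed.

HB.instance Definition _ :=
  GRing.isZmodMorphism.Build (hf_M X) pair_group univ_p univ_pB.

Lemma univ_quadratic_pair : quadratic_pair univ_p univ_mu.
Proof.
split=> [a a'|m|a]; apply: pair_groupP => N p mu e; have [muD ps pl] := e.
- by rewrite !raddfD /= !pair_desc_mu pair_desc_p muD.
- by rewrite !pair_desc_p.
- by rewrite raddfMn /= pair_desc_mu pair_desc_p.
Qed.

(** Hence an additive map out of [pair_group] is determined by, and equations
    between such maps can be tested on, the values at [univ_mu] and [univ_p]. *)
Lemma pair_groupE (x : pair_group) : exists a m, x = univ_mu a + univ_p m.
Proof.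
exists (repr x).1, (repr x).2; apply: pair_groupP => N p mu e.
by rewrite raddfD /= pair_desc_mu pair_desc_p.
Qed.

(** The quadratic pair [(hp, h mu)] of any refinement is forced, since
    [hp = 1 + star] and [h mu a = lam a a]. *)
Definition sym_p : {additive hf_M X -> hf_M X} := idfun \+ hf_star X.

Lemma hf_star_diag (a : hf_A X) : hf_star X (hf_lam a a) = hf_lam a a.
Proof. by rewrite -hf_herm. Qed.

Lemma sym_quadratic_pair : quadratic_pair sym_p (fun a => hf_lam a a).
Proof.
have [lDl lDr] := hf_biadd X.
split=> [a a'|m|a] /=.
- by rewrite lDl !lDr /= -hf_herm [hf_lam a' a + _]addrC addrACA.
- by rewrite hf_starK addrC.
- by rewrite hf_star_diag mulr2n.
Qed.

Definition univ_h : {additive pair_group -> hf_M X} :=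
  pair_desc sym_quadratic_pair.

Lemma univ_h_mu a : univ_h (univ_mu a) = hf_lam a a.
Proof. exact: pair_desc_mu. Qed.

Lemma univ_h_p m : univ_h (univ_p m) = m + hf_star X m.
Proof. exact: pair_desc_p. Qed.

Lemma univ_ph x : univ_p (univ_h x) = x *+ 2.
Proof.
have [a [m ->]] := pair_groupE x; have [_ ps pl] := univ_quadratic_pair.
rewrite [univ_h _]raddfD univ_h_mu univ_h_p !raddfD /= pl ps.
by rewrite mulrnDl -mulr2n.
Qed.

Lemma univ_star m : cq_star (CQGroup univ_ph) m = hf_star X m.
Proof. by rewrite /cq_star /= univ_h_p addrAC subrr add0r. Qed.

Lemma univ_cqform : @is_cqform _ (CQGroup univ_ph) (@hf_lam X) univ_mu.
Proof.
split=> [|a a'|a]; first exact: hf_biadd.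
- by have [muD _ _] := univ_quadratic_pair; exact: muD.
- exact: univ_h_mu.
Qed.

Definition univ_ref : refinement X := Refinement univ_star univ_cqform.

End Words.

(** * Universality of the refinement *)

Section Universality.
Variable X : hform.

Lemma ref_unit_star (r : refinement X) m :
  hf_star X m = hf_star (R (ref_form r)) m.
Proof. exact: (esym (@ref_star X r m)). Qed.

Definition ref_unit (r : refinement X) : @hom HF X (R (ref_form r)) :=
  @HFormHom X (R_obj (ref_form r)) (add_id _) (add_id _) (ref_unit_star r)
    (fun _ _ => erefl).

Lemma ref_over_unit (r : refinement X) :
  comp (ref_over r) (ref_unit r) = idm (X : HF).
Proof. exact: hform_hom_eq. Qed.

Lemma ref_unit_over (r : refinement X) :
  comp (ref_unit r) (ref_over r) = idm (R (ref_form r)).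
Proof. exact: hform_hom_eq. Qed.

Lemma over_idE (r s : refinement X) (f : @hom CQF (ref_form r) (ref_form s)) :
  over_id f <-> comp (fmap R f) (ref_unit r) = ref_unit s.
Proof.
split=> [E|E].
- rewrite -[fmap R f]comp_idl -ref_unit_over -!comp_assoc.
  by rewrite [comp (ref_over s) _]comp_assoc E ref_over_unit comp_idr.
- rewrite /over_id -[fmap R f]comp_idr -ref_unit_over comp_assoc comp_assoc.
  by rewrite -[X in comp X _]comp_assoc E ref_over_unit comp_idl.
Qed.

(** Morphisms of refinements are the factorizations of one canonical arrow
    through another. *)
Lemma universal_initial (r : refinement X) :
  universal_arrow (ref_unit r) -> @initial (refinements X) r.
Proof.
move=> rP s; have [g [/over_idE gP g_uniq]] := rP _ (ref_unit s).
exists (exist _ g gP); split=> // -[g' g'P] _.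
by apply: ref_hom_eq; apply: g_uniq; apply/over_idE.
Qed.

Variables (Y : cqform) (f : hform_hom X (R_obj Y)).

(** The middle condition holds as the involution of [Y] is [hp - 1], while
    [php = 2 p]. *)
Lemma pullback_quadratic_pair :
  quadratic_pair (add_comp (cq_p (cqf_M Y)) (hfh_M f))
    (fun a => cqf_mu (hfh_A f a)).
Proof.
have [_ muD hmu] := cqf_ax Y.
split=> [a a'|m|a] /=.
- by rewrite raddfD muD -hfh_lam.
- by rewrite hfh_star /= /cq_star /= raddfB cq_ph mulr2n addrK.
- by rewrite -hfh_lam /= -hmu cq_ph.
Qed.

Definition univ_fact_e : {additive pair_group X -> cq_e (cqf_M Y)} :=
  pair_desc pullback_quadratic_pair.

Lemma univ_fact_mu a : cqf_mu (hfh_A f a) = univ_fact_e (univ_mu a).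
Proof. by rewrite [univ_fact_e _]pair_desc_mu. Qed.

Lemma univ_fact_p m :
  univ_fact_e (univ_p m) = cq_p (cqf_M Y) (hfh_M f m).
Proof. exact: pair_desc_p. Qed.

Lemma univ_fact_h x : hfh_M f (univ_h X x) = cq_h (cqf_M Y) (univ_fact_e x).
Proof.
have [_ _ hmu] := cqf_ax Y; have [a [m ->]] := pair_groupE x.
rewrite [univ_h X _]raddfD [univ_fact_e _]raddfD univ_h_mu univ_h_p.
rewrite univ_fact_p -univ_fact_mu !raddfD /= hmu -hfh_lam hfh_star /=.
by rewrite /cq_star /= addrC [hfh_M f m + _]addrC subrK addrC.
Qed.

Definition univ_fact_M : cqgroup_hom (ref_M (univ_ref X)) (cqf_M Y) :=
  @CQGroupHom (ref_M (univ_ref X)) _ univ_fact_e (hfh_M f)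
    univ_fact_h univ_fact_p.

Definition univ_fact : cqform_hom (ref_form (univ_ref X)) Y :=
  @CQFormHom (ref_form (univ_ref X)) Y (hfh_A f) univ_fact_M
    (@hfh_lam _ _ f) univ_fact_mu.

End Universality.

(** Uniqueness holds because [pair_group] is spanned by the values of [univ_mu]
    and [univ_p], and a morphism of quadratic forms commutes with both. *)
Lemma univ_ref_universal (X : HF) : universal_arrow (ref_unit (univ_ref X)).
Proof.
move=> Y f; exists (univ_fact f); split; first exact: hform_hom_eq.
move=> g <-; apply: cqform_hom_eq => //= x.
have [a [m ->]] := pair_groupE x.
rewrite [LHS]raddfD [RHS]raddfD /= pair_desc_mu pair_desc_p /=.
by rewrite (cqfh_mu g a) (cqh_p (cqfh_M g) m).
Qed.

Theorem theorem38 :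
  exists mu : forall X : HF, refinements X,
    (forall X : HF, initial (mu X)) /\
    exists L : functor HF CQF,
      (forall X : HF, L X = ref_form (mu X)) /\ left_adjoint L R.
Proof.
exists univ_ref; split=> [X|].
- exact/universal_initial/univ_ref_universal.
- exact: (universal_left_adjoint univ_ref_universal).
Qed.
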